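(* Let $p$ be a prime, let $G$ be a countably based pro-$p$ group and let $g\in G$ be an element of order $p^k$. Then $$\dim_{\mathbb{F}_p[[G]]}\ \mathbb{F}_p[[G]]/\mathbb{F}_p[[G]](g-1)=\frac{1}{p^k}.$$
   Context: For an open normal subgroup $U$ of $G$ and a finitely presented left $\mathbb{F}_p[[G]]$-module $M$, $\dim_{\mathbb{F}_p[G/U]}M=\frac{\dim_{\mathbb{F}_p}(\mathbb{F}_p[G/U]\otimes_{\mathbb{F}_p[[G]]}M)}{|G:U|}$, and $\dim_{\mathbb{F}_p[[G]]}M=\inf_U \dim_{\mathbb{F}_p[G/U]}M$, the infimum over all open normal subgroups $U$ of $G$. *)

(* Defs.v *)
From HB Require Import structures.
From mathcomp Require Import all_boot all_order all_algebra all_fingroup.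
From mathcomp Require Import all_classical all_reals.
From mathcomp Require Import topology.
Set Implicit Arguments. Unset Strict Implicit. Unset Printing Implicit Defensive.
Import Order.TTheory GRing.Theory Num.Theory.
Local Open Scope classical_set_scope.
Local Open Scope ring_scope.

Record profinite_group := ProfiniteGroup {
  pg_car :> topologicalType;
  pg_mul : pg_car -> pg_car -> pg_car;
  pg_inv : pg_car -> pg_car;
  pg_one : pg_car;
  pg_mulA : forall x y z, pg_mul x (pg_mul y z) = pg_mul (pg_mul x y) z;
  pg_mul1g : forall x, pg_mul pg_one x = x;
  pg_mulVg : forall x, pg_mul (pg_inv x) x = pg_one;
  pg_mul_cont : continuous (fun xy : pg_car * pg_car => pg_mul xy.1 xy.2);
  pg_inv_cont : continuous pg_inv;
  pg_compact : compact [set: pg_car];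
  pg_hausdorff : hausdorff_space pg_car;
  pg_tdisc : totally_disconnected [set: pg_car]
}.

Section ProfiniteDefs.
Variable G : profinite_group.

Definition pg_exp (x : G) (n : nat) : G := iter n (pg_mul x) (pg_one G).

Definition pg_order_is (x : G) (m : nat) : Prop :=
  (0 < m)%N /\ pg_exp x m = pg_one G /\
  forall n, (0 < n < m)%N -> pg_exp x n <> pg_one G.

Definition open_normal_subgroup (U : set G) : Prop :=
  [/\ open U, U (pg_one G),
      (forall x y, U x -> U y -> U (pg_mul x y)),
      (forall x, U x -> U (pg_inv x)) &
      (forall x u, U u -> U (pg_mul (pg_mul x u) (pg_inv x)))].

Definition quotient_map (U : set G) (Q : finGroupType) (pi : G -> Q) : Prop :=
  [/\ forall x y, pi (pg_mul x y) = (pi x * pi y)%g,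
      forall q : Q, exists x, pi x = q &
      forall x, pi x = 1%g <-> U x].

Definition pro_p (p : nat) : Prop :=
  forall U, open_normal_subgroup U ->
  forall (Q : finGroupType) (pi : G -> Q), quotient_map U pi -> p.-nat #|Q|.

Definition countably_based : Prop := second_countable (T := G).

End ProfiniteDefs.

(* The matrix, in the basis Q of F_p[Q], of right multiplication by (h - 1):
   row x is the coordinate vector of x*(h-1) = xh - x.  Its row space is the
   left ideal F_p[Q](h-1). *)
Definition rmul_hm1_mx (p : nat) (Q : finGroupType) (h : Q) : 'M['F_p]_#|Q| :=
  \matrix_(i, j) (((enum_val j == (enum_val i * h)%g) : nat)%:R
                   - ((i == j) : nat)%:R).

Definition dim_quot_ideal (p : nat) (Q : finGroupType) (h : Q) : nat :=
  (#|Q| - \rank (rmul_hm1_mx p h))%N.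

(* r = dim_{F_p[G/U]} (F_p[[G]]/F_p[[G]](g-1))
     = dim_{F_p}(F_p[G/U] (x)_{F_p[[G]]} F_p[[G]]/F_p[[G]](g-1)) / |G:U|,
   where F_p[G/U] (x) F_p[[G]]/F_p[[G]](g-1) = F_p[G/U]/F_p[G/U](gU-1),
   computed via a realisation Q of G/U. *)
Definition dim_mod_U (R : realType) (p : nat) (G : profinite_group) (g : G)
    (U : set G) (r : R) : Prop :=
  exists (Q : finGroupType) (pi : G -> Q),
    quotient_map U pi /\
    r = ((dim_quot_ideal p (pi g))%:R / (#|Q|)%:R)%R.

(* dim_{F_p[[G]]} (F_p[[G]]/F_p[[G]](g-1)) = inf over open normal U *)
Definition dim_completed (R : realType) (p : nat) (G : profinite_group) (g : G) : R :=
  inf [set r : R | exists U : set G, open_normal_subgroup U /\ dim_mod_U p g U r].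

(* Main.v *)
(* For a finite group Q, right multiplication by h - 1 on F_p[Q] has as kernel
   the functions constant on the left cosets of <[h]>, so
   F_p[Q] / F_p[Q](h - 1) has dimension |Q : <[h]>|.  Hence each term of the
   infimum is 1 / #[g U], and #[g U] divides p ^ k.  The value 1 / p ^ k is
   attained: a profinite group is zero-dimensional, so some clopen
   neighbourhood of 1 misses g ^ (p ^ (k - 1)), and by compactness the normal
   core of its stabiliser is an open normal subgroup. *)

Require Import Defs.
From HB Require Import structures.
From mathcomp Require Import all_boot all_order all_algebra all_fingroup.
From mathcomp Require Import all_classical all_reals topology.
From mathcomp Require Import cyclic.
Import GRing.Theory Num.Theory.

Set Implicit Arguments. Unset Strict Implicit. Unset Printing Implicit Defensive.
Local Open Scope classical_set_scope.

Section ZeroDimensional.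
Variable T : topologicalType.
Hypothesis compactT : compact [set: T].

Lemma compact_clopen_nbhs_sub (x : T) (W : set T) : open W ->
  (forall y, ~ W y -> exists C : set T, [/\ clopen C, C x & ~ C y]) ->
  exists C : set T, [/\ clopen C, C x & C `<=` W].
Proof.
move=> oW sepW.
pose F := filter_from [set D : set T | D x /\ clopen D] id.
have FF : Filter F.
  apply: filter_from_filter; first by exists setT; split => //; exact: clopenT.
  by move=> A B [? ?] [? ?]; exists (A `&` B) => //; split=> //; exact: clopenI.
have PF : ProperFilter F by apply: filter_from_proper => ? [? _]; exists x.
suff [D [Dx cD] DW] : F W by exists D.
have /(iffLR (compact_near_coveringP _)) : compact (~` W).
  by apply: (subclosed_compact _ compactT) => //; exact: open_closedC.
move=> /(_ _ _ setC (powerset_filter_from_filter PF))[].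
  move=> y nWy; have [C [[oC cC] Cx Cy]] := sepW y nWy.
  exists (~` C, [set U | U `<=` C]); first split.
  - by apply: open_nbhs_nbhs; split => //; exact: closed_openC.
  - apply/near_powerset_filter_fromP; first by move=> ? ?; exact: subset_trans.
    by exists C => //; exists C.
  - by case=> i j [? /subsetC]; apply.
by move=> D [DF _ [C DC]]/(_ _ DC)/subsetC2/filterS; apply; exact: DF.
Qed.

Hypothesis hausdorffT : hausdorff_space T.

Lemma compact_separate_closed (A B : set T) :
  closed A -> closed B -> A `&` B = set0 ->
  exists U V : set T, [/\ open U, open V, A `<=` U, B `<=` V & U `&` V = set0].
Proof.
move=> cA cB AB.
have [|D DA clD] := @compact_normal _ hausdorffT compactT _ cA (~` B).
  move=> a Aa; apply: open_nbhs_nbhs; split; first exact: closed_openC.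
  by move=> Ba; have : (A `&` B) a by []; rewrite AB.
exists (interior D), (~` closure D); split.
- exact: open_interior.
- exact/closed_openC/closed_closure.
- by move=> a Aa; exact: DA.
- by move=> b Bb /clD.
- apply/seteqP; split => // z [/interior_subset Dz]; apply; exact: subset_closure.
Qed.

Definition quasi_component (x : T) : set T :=
  \bigcap_(C in [set C : set T | clopen C /\ C x]) C.

Lemma closed_quasi_component x : closed (quasi_component x).
Proof. by apply: closed_bigI => C [[]]. Qed.

(* Separate [Q `\` O] from [B] by disjoint open sets [U] and [V]; a clopen
   neighbourhood [C] of [x] inside [U `|` V] yields the clopen set [C `&` V],
   which contains [x] and hence all of [Q]. *)
Lemma quasi_component_sub_relclopen (x : T) (B O K : set T) :
  open O -> closed K -> B = quasi_component x `&` O ->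
  B = quasi_component x `&` K -> B x -> quasi_component x `<=` B.
Proof.
set Q := quasi_component x => oO cK BQO BQK Bx.
pose A := Q `&` ~` O.
have [|||U [V [oU oV AU BV UV]]] := @compact_separate_closed A B.
- by apply: closedI; [exact: closed_quasi_component | exact: open_closedC].
- by rewrite BQK; apply: closedI => //; exact: closed_quasi_component.
- by apply/seteqP; split => // z [[_ nOz]]; rewrite BQO => -[].
have UVz z : U z -> V z -> False.
  by move=> Uz Vz; have : (U `&` V) z by []; rewrite UV.
have QUV : Q `<=` U `|` V.
  move=> z Qz; have [Oz|nOz] := pselect (O z); first by right; apply: BV; rewrite BQO.
  by left; apply: AU.
have [|C [[oC cC] Cx CUV]] := @compact_clopen_nbhs_sub x _ (openU oU oV).
  move=> z nUVz; apply: contrapT => nsep; apply: nUVz; apply: QUV => D [cD Dx].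
  by apply: contrapT => nDz; apply: nsep; exists D.
have CVE : C `&` V = C `&` ~` U.
  apply/seteqP; split=> z [Cz Wz]; split => //.
    by move=> Uz; exact: UVz Uz Wz.
  by case: (CUV z Cz).
have clCV : clopen (C `&` V).
  split; first exact: openI.
  by rewrite CVE; apply: closedI => //; exact: open_closedC.
move=> z Qz; have [_ Vz] := Qz _ (conj clCV (conj Cx (BV x Bx))).
rewrite BQO; split => //; apply: contrapT => nOz.
exact: UVz (AU z (conj Qz nOz)) Vz.
Qed.

Lemma quasi_component_connected x : connected (quasi_component x).
Proof.
set Q := quasi_component x => B [b Bb] [O oO BQO] [K cK BQK].
have [Bx|nBx] := pselect (B x).
  apply/seteqP; split; last exact: quasi_component_sub_relclopen BQO BQK Bx.
  by rewrite BQO => z [].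
exfalso; pose B' := Q `&` ~` B.
have B'QK : B' = Q `&` ~` K.
  apply/seteqP; split=> z [Qz nz]; split=> // w; apply: nz.
    by rewrite BQK.
  by move: w; rewrite BQK => -[].
have B'QO : B' = Q `&` ~` O.
  apply/seteqP; split=> z [Qz nz]; split=> // w; apply: nz.
    by rewrite BQO.
  by move: w; rewrite BQO => -[].
have Qx : Q x by move=> C [].
have B'x : B' x by split.
have QB' : Q `<=` B'.
  exact: quasi_component_sub_relclopen (closed_openC cK) (open_closedC oO)
    B'QK B'QO B'x.
have Qb : Q b by move: Bb; rewrite BQO => -[].
by have [_] := QB' b Qb; apply.
Qed.

Lemma totally_disconnected_zero_dimensional :
  totally_disconnected [set: T] -> zero_dimensional T.
Proof.
move=> tdT x y /eqP xy.
have : quasi_component x `<=` connected_component [set: T] x.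
  apply: connected_component_max => //; first by move=> C [].
  exact: quasi_component_connected.
rewrite tdT // => Qx; apply: contrapT => nsep; apply: xy; apply/esym/Qx => C [cC Cx].
by apply: contrapT => nCy; apply: nsep; exists C.
Qed.

End ZeroDimensional.

Section ProfiniteGroupTheory.
Variable G : profinite_group.
Local Notation "x ** y" := (@pg_mul G x y) (at level 40, left associativity).
Local Notation inv := (@pg_inv G).
Local Notation one := (@pg_one G).

Lemma pg_mulKg (x y : G) : inv x ** (x ** y) = y.
Proof. by rewrite pg_mulA pg_mulVg pg_mul1g. Qed.

Lemma pg_mulgV (x : G) : x ** inv x = one.
Proof.
transitivity (inv (inv x) ** inv x ** (x ** inv x)).
  by rewrite pg_mulVg pg_mul1g.
by rewrite -pg_mulA (pg_mulA (inv x)) pg_mulVg pg_mul1g pg_mulVg.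
Qed.

Lemma pg_mulg1 (x : G) : x ** one = x.
Proof. by rewrite -(pg_mulVg x) pg_mulA pg_mulgV pg_mul1g. Qed.

Lemma pg_invgK (x : G) : inv (inv x) = x.
Proof. by rewrite -[inv (inv x)]pg_mulg1 -(pg_mulVg x) pg_mulKg. Qed.

Lemma pg_mulgVK (x y : G) : x ** inv y ** y = x.
Proof. by rewrite -pg_mulA pg_mulVg pg_mulg1. Qed.

Lemma pg_mulgKV (x y : G) : x ** y ** inv y = x.
Proof. by rewrite -pg_mulA pg_mulgV pg_mulg1. Qed.

Lemma pg_invg1 : inv one = one.
Proof. by rewrite -[inv one]pg_mulg1 pg_mulVg. Qed.

Lemma pg_invMg (x y : G) : inv (x ** y) = inv y ** inv x.
Proof.
rewrite -[RHS](pg_mulKg (x ** y)).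
by rewrite [_ ** (inv y ** inv x)]pg_mulA pg_mulgKV pg_mulgV pg_mulg1.
Qed.

Lemma continuous_pg_mul (T : topologicalType) (f g : T -> G) :
  continuous f -> continuous g -> continuous (fun t => f t ** g t).
Proof.
move=> cf cg t.
apply: (continuous_comp (f := fun t => (f t, g t)) (g := fun xy => xy.1 ** xy.2)).
  by apply: cvg_pair; [exact: cf | exact: cg].
exact: pg_mul_cont.
Qed.

Lemma continuous_pg_inv (T : topologicalType) (f : T -> G) :
  continuous f -> continuous (fun t => inv (f t)).
Proof. by move=> cf t; apply: continuous_comp; [exact: cf | exact: pg_inv_cont]. Qed.

Lemma continuous_pg_lmul (x : G) : continuous (pg_mul x).
Proof.
by apply: (@continuous_pg_mul _ (cst x) id) => ?; [exact: cvg_cst | exact: cvg_id].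
Qed.

Variable V : set G.

(* The normal core of the right stabiliser [set u | V ** u = V] of [V]. *)
Definition stab_core : set G :=
  [set u | forall x y, V (y ** (x ** u ** inv x)) <-> V y].

Lemma stab_core1 : stab_core one.
Proof. by move=> x y; rewrite pg_mulg1 pg_mulgV pg_mulg1. Qed.

Lemma stab_coreM u v : stab_core u -> stab_core v -> stab_core (u ** v).
Proof.
move=> Su Sv x y.
have -> : y ** (x ** (u ** v) ** inv x) = y ** (x ** u ** inv x) ** (x ** v ** inv x).
  by rewrite !pg_mulA pg_mulgVK.
by rewrite Sv Su.
Qed.

Lemma stab_coreV u : stab_core u -> stab_core (inv u).
Proof.
move=> Su x y; set y' := y ** (x ** inv u ** inv x).
have <- : y' ** (x ** u ** inv x) = y by rewrite /y' !pg_mulA !pg_mulgVK pg_mulgKV.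
by rewrite Su.
Qed.

Lemma stab_coreJ z u : stab_core u -> stab_core (z ** u ** inv z).
Proof.
move=> Su x y.
have -> : x ** (z ** u ** inv z) ** inv x = x ** z ** u ** inv (x ** z).
  by rewrite pg_invMg !pg_mulA.
exact: Su.
Qed.

Lemma stab_core_sub : V one -> stab_core `<=` V.
Proof. by move=> V1 u /(_ one one); rewrite pg_invg1 !pg_mul1g pg_mulg1 => ->. Qed.

Hypothesis clopenV : clopen V.

Lemma open_iff_mem (y : G) : open [set w | V w <-> V y].
Proof.
case: clopenV => oV cV; have [Vy|nVy] := pselect (V y).
  by rewrite (_ : [set w | _] = V) //; apply/seteqP; split=> w /=; tauto.
rewrite (_ : [set w | _] = ~` V); first exact: closed_openC.
by apply/seteqP; split=> w /=; tauto.
Qed.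

(* The tube lemma, through the compactness of [G * G]. *)
Lemma stab_core_nbhs1 : nbhs one stab_core.
Proof.
have cGG : compact [set: G * G].
  by rewrite -setXTT; apply: compact_setX; exact: pg_compact.
pose P u (xy : G * G) := V (xy.2 ** (xy.1 ** u ** inv xy.1)) <-> V xy.2.
suff : \forall u \near nbhs one, [set: G * G] `<=` P u.
  by apply: filterS => u Pu x y; exact: (Pu (x, y) I).
apply: ((compact_near_coveringP _).1 cGG G (nbhs one) P _) => -[x y] _.
pose f (z : G * G * G) := z.1.2 ** (z.1.1 ** z.2 ** inv z.1.1).
have c1 : continuous (fun z : G * G * G => z.1.1).
  by move=> z; apply: continuous_comp; [exact: cvg_fst | exact: cvg_fst].
have c2 : continuous (fun z : G * G * G => z.1.2).
  by move=> z; apply: continuous_comp; [exact: cvg_fst | exact: cvg_snd].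
have cf : continuous f.
  apply: continuous_pg_mul c2 (continuous_pg_mul (continuous_pg_mul c1 _)
    (continuous_pg_inv c1)) => z; exact: cvg_snd.
pose O := [set w | V w <-> V y].
have nbhsO : nbhs y O by apply: open_nbhs_nbhs; split=> //; exact: open_iff_mem.
have Nf : nbhs ((x, y), one) (f @^-1` O).
  by apply: cf; rewrite /f /= pg_mulg1 pg_mulgV pg_mulg1.
have N2 : nbhs ((x, y), one) ((fun z : G * G * G => z.1.2) @^-1` O) by exact: c2.
apply: filterS (filterI Nf N2) => -[[x' y'] u] [h1 h2].
by rewrite /P /O /f /= in h1 h2 *; tauto.
Qed.

Lemma open_stab_core : open stab_core.
Proof.
rewrite openE => u Su.
have : nbhs u (pg_mul (inv u) @^-1` stab_core).
  by apply: continuous_pg_lmul; rewrite /= pg_mulVg; exact: stab_core_nbhs1.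
apply: filterS => w /= Sw.
by rewrite -(pg_mulKg (inv u) w) pg_invgK; exact: stab_coreM.
Qed.

Lemma open_normal_subgroup_stab_core : open_normal_subgroup stab_core.
Proof.
split.
- exact: open_stab_core.
- exact: stab_core1.
- exact: stab_coreM.
- exact: stab_coreV.
- by move=> x u; exact: stab_coreJ.
Qed.

End ProfiniteGroupTheory.

Lemma open_normal_subgroup_avoid (G : profinite_group) (h : G) :
  h <> pg_one G -> exists U : set G, open_normal_subgroup U /\ ~ U h.
Proof.
move=> h1; have zdG := totally_disconnected_zero_dimensional
  (@pg_compact G) (@pg_hausdorff G) (@pg_tdisc G).
have [|V [clV V1 nVh]] := zdG (pg_one G) h; first by apply/eqP=> /esym.
exists (stab_core V); split; first exact: open_normal_subgroup_stab_core.
by move/(stab_core_sub V1).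
Qed.

Lemma pg_finite_subcover (G : profinite_group) (f : G -> set G) :
  (forall i, open (f i)) -> (forall z, exists i, f i z) ->
  exists s : seq G, forall z, exists2 i, i \in s & f i z.
Proof.
move=> open_f cov.
(* [compact_cover] is stated for pointed spaces; [G] is pointed by its unit. *)
pose pG : ptopologicalType := HB.pack (pg_car G) (isPointed.Build _ (pg_one G)).
have : compact [set: pG] by exact: pg_compact.
rewrite compact_cover => /(_ pG [set: pG] f) [].
- by move=> i _; exact: open_f.
- by move=> z _; have [i fiz] := cov z; exists i.
move=> D _ Dcov; exists (finmap.enum_fset D) => z.
by have [i Di fiz] := Dcov z I; exists i.
Qed.

Section FiniteQuotient.
Variable G : profinite_group.
Local Notation "x ** y" := (@pg_mul G x y) (at level 40, left associativity).
Local Notation inv := (@pg_inv G).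
Local Notation one := (@pg_one G).
Variable U : set G.
Hypothesis nsgU : open_normal_subgroup U.

Let U1 : U one. Proof. by case: nsgU. Qed.
Let UM x y : U x -> U y -> U (x ** y). Proof. by case: nsgU => _ _ + _ _; apply. Qed.
Let UV x : U x -> U (inv x). Proof. by case: nsgU => _ _ _ + _; apply. Qed.
Let UJ x u : U u -> U (x ** u ** inv x). Proof. by case: nsgU => _ _ _ _ +; apply. Qed.

Definition pg_lcoset (w : G) : set G := [set z | U (inv w ** z)].

Lemma pg_lcoset_refl w : pg_lcoset w w.
Proof. by rewrite /pg_lcoset /= pg_mulVg. Qed.

Lemma pg_lcoset_eq a b : U (inv a ** b) -> pg_lcoset a = pg_lcoset b.
Proof.
move=> Uab; apply/seteqP; split => z; rewrite /pg_lcoset /= => Uz.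
  have -> : inv b ** z = inv (inv a ** b) ** (inv a ** z).
    by rewrite pg_invMg pg_invgK !pg_mulA pg_mulgKV.
  by apply: UM => //; exact: UV.
have -> : inv a ** z = inv a ** b ** (inv b ** z) by rewrite pg_mulA pg_mulgKV.
exact: UM.
Qed.

Lemma pg_lcoset_eqP a b : pg_lcoset a = pg_lcoset b -> U (inv a ** b).
Proof. by move=> ab; have := pg_lcoset_refl b; rewrite -ab. Qed.

Lemma open_pg_lcoset w : open (pg_lcoset w).
Proof.
apply: (open_comp (f := pg_mul (inv w))); last by case: nsgU.
by move=> z _; exact: continuous_pg_lmul.
Qed.

Lemma finite_lcoset_reps :
  exists s : seq G, forall z, exists2 w, w \in s & pg_lcoset w z.
Proof.
apply: pg_finite_subcover open_pg_lcoset _ => z.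
by exists z; exact: pg_lcoset_refl.
Qed.

Definition lcoset_reps : seq G := projT1 (cid finite_lcoset_reps).

Definition lcoset_list : seq (set G) := undup [seq pg_lcoset w | w <- lcoset_reps].

Lemma mem_lcoset_list w : pg_lcoset w \in lcoset_list.
Proof.
have [v vr vw] := projT2 (cid finite_lcoset_reps) w.
by rewrite mem_undup; apply/mapP; exists v => //; exact/esym/pg_lcoset_eq.
Qed.

Lemma lcoset_listP C : C \in lcoset_list -> exists w, C = pg_lcoset w.
Proof. by rewrite mem_undup => /mapP [w _ ->]; exists w. Qed.

Definition rmul_set (S : set G) (x : G) : set G := [set z | S (z ** inv x)].

Lemma rmul_set_lcoset w x : rmul_set (pg_lcoset w) x = pg_lcoset (w ** x).
Proof.
apply/seteqP; split => z; rewrite /rmul_set /pg_lcoset /= => Uz.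
  by have := UJ (inv x) Uz; rewrite pg_invgK pg_invMg !pg_mulA pg_mulgVK.
by have := UJ x Uz; rewrite pg_invMg !pg_mulA pg_mulgV pg_mul1g.
Qed.

Lemma rmul_setK S x : rmul_set (rmul_set S x) (inv x) = S.
Proof. by apply/seteqP; split => z; rewrite /rmul_set /= pg_invgK pg_mulgKV. Qed.

Lemma rmul_setM S x y : rmul_set S (x ** y) = rmul_set (rmul_set S x) y.
Proof. by apply/seteqP; split => z; rewrite /rmul_set /= pg_invMg pg_mulA. Qed.

(* [G] acts by right multiplication on its finitely many left cosets modulo
   [U]; the image of this action in [{perm coset}] realises [G / U]. *)
Local Notation coset := (seq_sub lcoset_list).

Definition coset_act (x : G) (C : coset) : coset :=
  insubd (SeqSub (mem_lcoset_list one)) (rmul_set (val C) x).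

Lemma val_coset_act x C : val (coset_act x C) = rmul_set (val C) x.
Proof.
apply: insubdK; have [w ->] := lcoset_listP (valP C).
by rewrite rmul_set_lcoset mem_lcoset_list.
Qed.

Lemma coset_actK x : cancel (coset_act x) (coset_act (inv x)).
Proof. by move=> C; apply: val_inj; rewrite !val_coset_act rmul_setK. Qed.

Definition coset_perm x : {perm coset} := perm (can_inj (coset_actK x)).

Lemma coset_permE x C : coset_perm x C = coset_act x C.
Proof. exact: permE. Qed.

Lemma coset_permM x y : coset_perm (x ** y) = (coset_perm x * coset_perm y)%g.
Proof.
apply/permP => C; rewrite permM !coset_permE; apply: val_inj.
by rewrite !val_coset_act rmul_setM.
Qed.

Lemma coset_perm1P x : coset_perm x = 1%g <-> U x.
Proof.
split => [x1|Ux].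
  pose C1 : coset := SeqSub (mem_lcoset_list one).
  have := congr1 (fun s : {perm coset} => val (s C1)) x1.
  rewrite perm1 coset_permE val_coset_act /= rmul_set_lcoset.
  move=> /esym/pg_lcoset_eqP.
  by rewrite pg_invg1 !pg_mul1g.
apply/permP => C; rewrite perm1 coset_permE; apply: val_inj; rewrite val_coset_act.
have [w ->] := lcoset_listP (valP C); rewrite rmul_set_lcoset.
by apply/esym/pg_lcoset_eq; rewrite pg_mulKg.
Qed.

Definition coset_perm_image : {set {perm coset}} :=
  [set s | `[< exists x, coset_perm x = s >]].

Lemma coset_perm_imageP s :
  reflect (exists x, coset_perm x = s) (s \in coset_perm_image).
Proof. by rewrite inE; exact: asboolP. Qed.

Lemma group_set_coset_perm_image : group_set coset_perm_image.
Proof.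
apply/group_setP; split.
  by apply/coset_perm_imageP; exists one; exact/coset_perm1P.
move=> _ _ /coset_perm_imageP[x <-] /coset_perm_imageP[y <-].
by apply/coset_perm_imageP; exists (x ** y); rewrite coset_permM.
Qed.

Canonical coset_perm_group := Group group_set_coset_perm_image.

Lemma coset_perm_in x : coset_perm x \in coset_perm_group.
Proof. by apply/coset_perm_imageP; exists x. Qed.

Lemma quotient_map_coset_perm :
  quotient_map U (fun x => subg coset_perm_group (coset_perm x)).
Proof.
split.
- by move=> x y; rewrite coset_permM subgM // coset_perm_in.
- move=> q; have /coset_perm_imageP[x xq] := subgP q.
  by exists x; rewrite xq sgvalK.
- move=> x; rewrite -coset_perm1P; split => [/(congr1 sgval)|->].
    by rewrite subgK ?coset_perm_in.
  by apply: val_inj; rewrite /= subgK ?group1.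
Qed.

End FiniteQuotient.

Lemma exists_quotient_map (G : profinite_group) (U : set G) :
  open_normal_subgroup U ->
  exists (Q : finGroupType) (pi : G -> Q), quotient_map U pi.
Proof. by move=> nsgU; eexists; eexists; exact: quotient_map_coset_perm. Qed.

Section CosetIndicatorMatrix.
Variables (p : nat) (Q : finGroupType) (h : Q).
Local Notation n := #|Q|.
Local Notation F := 'F_p.
Local Notation H := <[h]>%G.
Local Notation L := (lcosets H [set: Q]%SET).
Local Notation c := #|L|.
Local Notation M := (rmul_hm1_mx p h).
Local Open Scope ring_scope.

Definition coset_indicator_mx : 'M[F]_(c, n) :=
  \matrix_(i < c, j < n) ((enum_val j \in (enum_val i : {set Q})) : nat)%:R.

Definition coset_repr_mx : 'M[F]_(n, c) :=
  \matrix_(j < n, k < c) ((enum_val j == repr (enum_val k : {set Q})) : nat)%:R.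

Lemma natr_bool (b : bool) : ((b : nat)%:R : F) = if b then 1 else 0.
Proof. by case: b. Qed.

Lemma sum_mul_eq_ord (f : 'I_n -> F) (j : 'I_n) :
  \sum_(l < n) f l * ((l == j) : nat)%:R = f j.
Proof.
rewrite (bigD1 j) //= eqxx mulr1 big1 ?addr0 // => l /negbTE ->.
by rewrite mulr0.
Qed.

Lemma sum_mul_eq_rmul (f : Q -> F) (y : Q) :
  \sum_(l < n) f (enum_val l) * ((y == (enum_val l * h)%g) : nat)%:R = f (y * h^-1)%g.
Proof.
rewrite -(big_enum_val (fun x => f x * ((y == (x * h)%g) : nat)%:R)) /=.
rewrite (bigD1 (y * h^-1)%g) //= mulgKV eqxx mulr1 big1 ?addr0 // => x xy.
by rewrite natr_bool; case: eqP => [yx|]; [rewrite yx mulgK eqxx in xy | rewrite mulr0].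
Qed.

Lemma row_rmul_hm1 (u : 'rV[F]_n) (j : 'I_n) :
  (u *m M) 0 j = u 0 (enum_rank (enum_val j * h^-1)%g) - u 0 j.
Proof.
rewrite !mxE; under eq_bigr do rewrite !mxE mulrBr.
rewrite sumrB sum_mul_eq_ord; congr (_ - _).
rewrite -(sum_mul_eq_rmul (fun x => u 0 (enum_rank x))).
by apply: eq_bigr => l _; rewrite enum_valK.
Qed.

Lemma lcoset_mulgV (C : {set Q}) x : C \in L -> ((x * h^-1)%g \in C) = (x \in C).
Proof.
by case/lcosetsP => y _ ->; rewrite !mem_lcoset mulgA groupMr // groupV cycle_id.
Qed.

Lemma lcoset_eq_mem (C : {set Q}) x : C \in L -> x \in C -> C = (x *: H)%g.
Proof. by case/lcosetsP => y _ -> /lcoset_eqP ->. Qed.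

Lemma lcoset_in_lcosets x : (x *: H)%g \in L.
Proof. by rewrite mem_lcosets mulGSid ?finset.subsetT ?finset.in_setT. Qed.

Lemma coset_indicator_mx_rmul_hm1 : coset_indicator_mx *m M = 0.
Proof.
apply/row_matrixP => i; rewrite row_mul row0; apply/rowP => j.
by rewrite row_rmul_hm1 !mxE enum_rankK lcoset_mulgV ?enum_valP // subrr.
Qed.

(* A row vector killed by right multiplication by [h - 1] is constant on the
   left cosets of [<[h]>], hence a combination of the rows of
   [coset_indicator_mx]. *)
Lemma kermx_rmul_hm1_sub : (kermx M <= coset_indicator_mx)%MS.
Proof.
apply/row_subP => i; set u := row i (kermx M).
have uM : u *m M = 0 by apply/eqP; rewrite -sub_kermx row_sub.
clearbody u; pose f x := u 0 (enum_rank x).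
have fhV x : f (x * h^-1)%g = f x.
  have /eqP := congr1 (fun v : 'rV[F]_n => v 0 (enum_rank x)) uM.
  by rewrite row_rmul_hm1 enum_rankK mxE subr_eq0 => /eqP.
have f_coset x y : y \in (x *: H)%g -> f y = f x.
  rewrite mem_lcoset => /cycleP [k yk]; rewrite -(mulKVg x y) yk {y yk}.
  elim: k x => [|k IHk] x; first by rewrite expg0 mulg1.
  by rewrite expgSr mulgA -fhV mulgK IHk.
apply/submxP; exists (\row_k f (repr (enum_val k : {set Q}))).
apply/rowP => j; rewrite !mxE; set x := enum_val j.
rewrite (bigD1 (enum_rank_in (lcoset_in_lcosets x) (x *: H)%g)) //= big1 ?addr0.
  rewrite !mxE enum_rankK_in ?lcoset_in_lcosets // lcoset_refl mulr1.
  have -> : u 0 j = f x by rewrite /f /x enum_valK.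
  by symmetry; apply: f_coset; apply: mem_repr (lcoset_refl _ _).
move=> k kx; rewrite !mxE natr_bool; case: ifP => [xk|_]; last by rewrite mulr0.
have kxH : enum_val k = (x *: H)%g by apply: lcoset_eq_mem (enum_valP k) xk.
by move: kx; rewrite -(enum_valK_in (lcoset_in_lcosets x) k) kxH eqxx.
Qed.

Lemma coset_indicator_mx_repr : coset_indicator_mx *m coset_repr_mx = 1%:M.
Proof.
apply/matrixP => k k'; rewrite !mxE; under eq_bigr do rewrite !mxE.
set C' : {set Q} := enum_val k'.
rewrite -(big_enum_val (fun x => ((x \in (enum_val k : {set Q})) : nat)%:R *
   ((x == repr C') : nat)%:R)) /=.
rewrite (bigD1 (repr C')) //= eqxx mulr1 big1 ?addr0; last first.
  by move=> x /negbTE ->; rewrite mulr0.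
have [y _ C'y] := lcosetsP (enum_valP k').
have reprC' : repr C' \in C' by rewrite /C' C'y; apply: mem_repr (lcoset_refl _ _).
rewrite !natr_bool; case: (eqVneq k k') => [->|kk']; case: ifP => // kC'.
  by rewrite reprC' in kC'.
case/eqP: kk'; apply: enum_val_inj.
by rewrite (lcoset_eq_mem (enum_valP k) kC') -(lcoset_eq_mem (enum_valP k') reprC').
Qed.

Lemma rank_coset_indicator_mx : \rank coset_indicator_mx = c.
Proof.
apply/eqP; rewrite eqn_leq rank_leq_row /=.
by rewrite -{1}(mxrank1 F c) -coset_indicator_mx_repr mxrankM_maxl.
Qed.

Lemma dim_quot_ideal_index : dim_quot_ideal p h = #|[set: Q]%SET : H|%g.
Proof.
rewrite /dim_quot_ideal -mxrank_ker -card_lcosets -rank_coset_indicator_mx.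
apply/eqP; rewrite eqn_leq (mxrankS kermx_rmul_hm1_sub) mxrankS //.
by rewrite sub_kermx coset_indicator_mx_rmul_hm1.
Qed.

End CosetIndicatorMatrix.

Section QuotientMapOrder.
Variables (G : profinite_group) (U : set G) (Q : finGroupType) (pi : G -> Q).
Hypothesis piU : quotient_map U pi.

Lemma quotient_map1 : pi (pg_one G) = 1%g.
Proof.
case: piU => piM _ _; apply: (@mulgI _ (pi (pg_one G))).
by rewrite -piM pg_mul1g mulg1.
Qed.

Lemma quotient_map_exp (x : G) n : pi (pg_exp x n) = (pi x ^+ n)%g.
Proof.
elim: n => [|n IHn]; first exact: quotient_map1.
by case: piU => piM _ _; rewrite /pg_exp /= piM -/(pg_exp x n) IHn expgS.
Qed.

Lemma order_quotient_map_dvdn (x : G) m :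
  pg_exp x m = pg_one G -> (#[pi x]%g %| m)%N.
Proof. by move=> xm; rewrite order_dvdn -quotient_map_exp xm quotient_map1. Qed.

End QuotientMapOrder.

Lemma dim_quot_ideal_ratio (R : realType) p (Q : finGroupType) (h : Q) :
  ((dim_quot_ideal p h)%:R / #|Q|%:R : R)%R = (#[h]%g%:R)^-1%R.
Proof.
rewrite dim_quot_ideal_index; have := Lagrange (finset.subsetT <[h]>%G).
rewrite cardsT => <-.
by rewrite natrM invfM mulrCA divff ?mulr1 // pnatr_eq0 -lt0n indexg_gt0.
Qed.

Lemma inf_lbound_mem (R : realType) (S : set R) x : S x -> lbound S x -> inf S = x.
Proof.
move=> Sx lbSx; apply/Order.POrderTheory.le_anti/andP; split.
  by apply: ge_inf Sx; exists x.
by apply: lb_le_inf; first exists x.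
Qed.

(* For [k > 0], an open normal subgroup avoiding [g ^ (p ^ (k - 1))] keeps the
   full order of [g] in the quotient. *)
Lemma open_normal_subgroup_quotient_order (G : profinite_group) (g : G) p k :
  prime p -> pg_order_is g (p ^ k) ->
  exists2 U : set G, open_normal_subgroup U &
    forall (Q : finGroupType) (pi : G -> Q), quotient_map U pi -> #[pi g]%g = p ^ k.
Proof.
move=> p_pr [_ [gk gmin]].
have [U nsgU Ugk] : exists2 U : set G, open_normal_subgroup U &
    (0 < k -> ~ U (pg_exp g (p ^ k.-1)))%N.
  have [k0|k_gt0] := posnP k.
    by exists setT; [split=> //; exact: openT | rewrite k0].
  have [|U [nsgU nUg]] := @open_normal_subgroup_avoid G (pg_exp g (p ^ k.-1)).
    apply: gmin; rewrite expn_gt0 prime_gt0 //=.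
    by rewrite ltn_exp2l ?prime_gt1 // prednK.
  by exists U.
exists U => // Q pi piU.
have /(dvdn_pfactor _ _ p_pr)[j j_le_k ord_pig] := order_quotient_map_dvdn piU gk.
rewrite ord_pig.
have [j_lt_k|k_le_j] := ltnP j k; last by congr (_ ^ _); apply/anti_leq/andP.
have k_gt0 : (0 < k)%N by apply: leq_ltn_trans j_lt_k.
case: (Ugk k_gt0); have [_ _ <-] := piU.
apply/eqP; rewrite (quotient_map_exp piU) -order_dvdn.
by rewrite ord_pig; apply: dvdn_exp2l; rewrite -ltnS prednK.
Qed.

Theorem lemma4p6 (R : realType) (p : nat) (G : profinite_group) (g : G) (k : nat) :
  prime p -> pro_p G p -> countably_based G -> pg_order_is g (p ^ k) ->
  dim_completed R p g = ((p ^ k)%:R)^-1%R.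
Proof.
move=> p_pr _ _ gk; apply: inf_lbound_mem.
  have [U nsgU piU_order] := open_normal_subgroup_quotient_order p_pr gk.
  have [Q [pi piU]] := exists_quotient_map nsgU.
  exists U; split=> //; exists Q, pi; split=> //.
  by rewrite dim_quot_ideal_ratio piU_order.
move=> _ [U [_ [Q [pi [piU ->]]]]]; rewrite dim_quot_ideal_ratio.
have [_ [gk1 _]] := gk.
have pk_gt0 : (0 < p ^ k)%N by rewrite expn_gt0 prime_gt0.
rewrite lef_pV2 ?posrE ?ltr0n ?order_gt0 // ler_nat.
exact/dvdn_leq/(order_quotient_map_dvdn piU gk1).
Qed.
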